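(* Let $\Gamma$ be a finite, simple, connected, undirected, regular graph with vertex set $X$, adjacency matrix $A$, and exactly $d+1$ distinct eigenvalues. If $\mathcal{A}=\operatorname{span}\{I,A,\ldots,A^d\}$ is closed under Hadamard multiplication, then for every vertex $x$ there exists an $x$-distance-faithful intersection diagram of $\Gamma$ with $d+1$ cells. Moreover, this intersection diagram is the same around every vertex.
   Context: A partition $\pi_x=\{\mathcal{P}_0,\mathcal{P}_1,\ldots,\mathcal{P}_r\}$ of $X$ with $\mathcal{P}_0=\{x\}$ is $x$-distance-faithful if it refines the distance partition $\{\Gamma_0(x),\Gamma_1(x),\ldots,\Gamma_{\varepsilon(x)}(x)\}$ around $x$ (where $\Gamma_h(x)$ is the set of vertices at distance $h$ from $x$ and $\varepsilon(x)$ the eccentricity of $x$), i.e. all vertices in a cell are at the same distance from $x$. It is equitable if for all $i,j$ the number $c_{ij}$ of neighbours a vertex of $\mathcal{P}_i$ has in $\mathcal{P}_j$ does not depend on the chosen vertex of $\mathcal{P}_i$; its intersection diagram records the cells and the parameters $c_{ij}$. An $x$-distance-faithful intersection diagram is the intersection diagram of an equitable $x$-distance-faithful partition. ''The same around every vertex'' means: there are an integer $r$, numbers $c_{ij}$, sizes $s_i$ and distances $\delta_i$ ($0\le i,j\le r$) such that for every vertex $u$ there is an equitable $u$-distance-faithful partition $\{\mathcal{P}_0(u)=\{u\},\ldots,\mathcal{P}_r(u)\}$ with $|\mathcal{P}_i(u)|=s_i$, every vertex of $\mathcal{P}_i(u)$ at distance $\delta_i$ from $u$, and corresponding parameters $c_{ij}$.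 *)

(* Defs.v *)
From HB Require Import structures.
From mathcomp Require Import all_boot all_order all_algebra.

Set Implicit Arguments.
Unset Strict Implicit.
Unset Printing Implicit Defensive.

Import GRing.Theory Num.Theory.

(* A simple graph on the finite vertex type T is a symmetric irreflexive
   relation e : rel T. *)
Section Graphs.
Variables (T : finType) (e : rel T).

Definition neighbours (x : T) : {set T} := [set y | e x y].

Definition regular_graph : Prop :=
  exists k : nat, forall x : T, #|neighbours x| = k.

Definition connected_graph : Prop := forall x y : T, connect e x y.

Definition walk_of_length (x y : T) (h : nat) : bool :=
  [exists p : h.-tuple T, path e x p && (last x p == y)].

(* Least length of a walk from x to y; a shortest walk repeats no vertex, so
   only the lengths below #|T| need be searched.  The value is #|T| when y is
   not reachable from x. *)
Definition gdist (x y : T) : nat := find (walk_of_length x y) (iota 0 #|T|).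

Definition sphere (x : T) (h : nat) : {set T} := [set y | gdist x y == h].

Definition eccentricity (x : T) : nat := \max_(y : T) gdist x y.

Definition distance_partition (x : T) : {set {set T}} :=
  [set sphere x h | h : 'I_(eccentricity x).+1].

(* The cells P 0, ..., P r are pairwise distinct, and form a partition of T
   (in particular they are nonempty). *)
Definition indexed_partition (r : nat) (P : 'I_r.+1 -> {set T}) : Prop :=
  injective P /\ partition [set P i | i : 'I_r.+1] [set: T].

Definition distance_faithful (x : T) (r : nat) (P : 'I_r.+1 -> {set T}) : Prop :=
  [/\ indexed_partition P,
      P ord0 = [set x]
    & forall i, exists2 D, D \in distance_partition x & P i \subset D].

Definition equitable_with (r : nat) (P : 'I_r.+1 -> {set T})
    (c : 'I_r.+1 -> 'I_r.+1 -> nat) : Prop :=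
  forall i j y, y \in P i -> #|neighbours y :&: P j| = c i j.

Definition equitable (r : nat) (P : 'I_r.+1 -> {set T}) : Prop :=
  exists c, equitable_with P c.

Definition has_distance_faithful_diagram (x : T) (r : nat) : Prop :=
  exists P : 'I_r.+1 -> {set T}, distance_faithful x P /\ equitable P.

Definition same_diagram_around_every_vertex (r : nat) : Prop :=
  exists (c : 'I_r.+1 -> 'I_r.+1 -> nat) (s delta : 'I_r.+1 -> nat),
  forall u : T, exists P : 'I_r.+1 -> {set T},
    [/\ distance_faithful u P,
        equitable_with P c,
        forall i, #|P i| = s i
      & forall i y, y \in P i -> gdist u y = delta i].

End Graphs.

Local Open Scope ring_scope.

(* Rows and columns are indexed by T through its enumeration. *)
Definition adjacency_matrix (C : numClosedFieldType) (T : finType) (e : rel T)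
    : 'M[C]_#|T| :=
  \matrix_(i, j) (e (enum_val i) (enum_val j))%:R.

Definition num_distinct_eigenvalues (F : fieldType) (n : nat) (A : 'M[F]_n)
    (m : nat) : Prop :=
  exists s : seq F,
    [/\ uniq s, size s = m & forall a, (a \in s) = eigenvalue A a].

Definition power_span (F : fieldType) (n : nat) (A : 'M[F]_n) (d : nat)
    : {vspace 'M[F]_n} :=
  <<[seq A ^+ k | k <- iota 0 d.+1]>>%VS.

Definition hadamard (F : fieldType) (n : nat) (M N : 'M[F]_n) : 'M[F]_n :=
  map2_mx *%R M N.

Definition hadamard_closed (F : fieldType) (n : nat) (U : {vspace 'M[F]_n})
    : Prop :=
  forall M N, M \in U -> N \in U -> hadamard M N \in U.

(* Main.v *)
Require Import Defs.
From HB Require Import structures.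
From mathcomp Require Import all_boot all_order all_algebra.
From mathcomp Require Import ring.

(* Let [V] be the span of the powers of [A]. As [A] is diagonalizable, a
   matrix lies in [V] as soon as it acts on every eigenvector as a scalar
   depending only on the eigenvalue: interpolate this scalar by a polynomial
   of degree at most [d]. Hence [V] contains all powers of [A], and also the
   all-ones matrix [J], which acts as [#|T|] on the constant vectors, these
   being by connectedness the whole eigenspace of the valency, and as [0] on
   all other eigenvectors. Being closed under the Hadamard product and
   containing [J], [V] has as basis the 0/1 matrices of the classes of pairs
   of vertices that no matrix of [V] separates, of which there are therefore
   [d + 1]. The cells around [x] are the rows of these classes at [x].
   Matrices of [V] have constant row sums, so the sizes of the cells do not
   depend on the vertex and no cell is empty; applied to Hadamard products
   with [I], this makes the diagonal a single class. Finally the distance is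
   read off the supports of the powers of [A], and the numbers of neighbours
   in a cell are the entries of the product of its class matrix with [A],
   which lies in [V]: both depend only on the class. *)

Set Implicit Arguments.
Unset Strict Implicit.
Unset Printing Implicit Defensive.

Import GRing.Theory Num.Theory.
Local Open Scope ring_scope.

Lemma mulmx_onesE (R : pzSemiRingType) m n p (M : 'M[R]_(m, n)) i (j : 'I_p) :
  (M *m const_mx 1) i j = \sum_k M i k.
Proof. by rewrite mxE; apply: eq_bigr => k _; rewrite mxE mulr1. Qed.

Lemma sumr_indicator (R : pzSemiRingType) (T : finType) (S : {set T}) :
  \sum_x (x \in S)%:R = #|S|%:R :> R.
Proof.
rewrite -sum1_card natr_sum [RHS]big_mkcond.
by apply: eq_bigr => x _; case: (x \in S).
Qed.

Lemma sum_enum_rank (V : nmodType) (T : finType) (F : 'I_#|T| -> V) :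
  \sum_i F i = \sum_x F (enum_rank x).
Proof. by rewrite (reindex _ (onW_bij _ (@enum_rank_bij T))). Qed.

Lemma mulmx_expr_eigenvector (R : comPzRingType) m n (A : 'M[R]_n) a
    (v : 'M_(m, n)) k :
  v *m A = a *: v -> v *m A ^+ k = a ^+ k *: v.
Proof.
move=> vA; elim: k => [|k IH]; first by rewrite mulmx1 scale1r.
by rewrite exprSr mulmxA IH -scalemxAl vA scalerA -exprSr.
Qed.

Lemma expr_mulmx_eigenvector (R : comPzRingType) m n (A : 'M[R]_m) a
    (v : 'M_(m, n)) k :
  A *m v = a *: v -> A ^+ k *m v = a ^+ k *: v.
Proof.
move=> Av; elim: k => [|k IH]; first by rewrite mul1mx scale1r.
by rewrite exprSr -mulmxA Av -scalemxAr IH scalerA -exprS.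
Qed.

Lemma unitmx_Vandermonde (F : fieldType) n (a : 'rV[F]_n) :
  injective (a 0) -> Vandermonde n a \in unitmx.
Proof.
move=> a_inj; rewrite unitmxE det_Vandermonde unitfE.
apply/prodf_neq0 => i _; apply/prodf_neq0 => j lt_ij.
by rewrite subr_eq0 (inj_eq a_inj) -val_eqE gtn_eqF.
Qed.

Lemma num_distinct_eigenvaluesP (F : fieldType) n (A : 'M[F]_n) m :
  num_distinct_eigenvalues A m ->
  exists2 a : 'rV[F]_m, injective (a 0) &
    forall b, eigenvalue A b <-> exists i, b = a 0 i.
Proof.
move=> [s [s_uniq s_size s_eig]]; exists (\row_i s`_i) => [i j|b].
  by rewrite !mxE => /eqP; rewrite nth_uniq ?s_size // => /eqP/val_inj.
rewrite -s_eig; split=> [/(nthP 0)[i lt_i <-]|[i ->]].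
  by rewrite s_size in lt_i; exists (Ordinal lt_i); rewrite mxE.
by rewrite mxE mem_nth ?s_size.
Qed.

Lemma eq_mx_on_eigenvectors (F : fieldType) m n (A : 'M[F]_m)
    (M N : 'M[F]_(m, n)) :
  diagonalizable A ->
  (forall a (v : 'rV_m), v *m A = a *: v -> v *m M = v *m N) -> M = N.
Proof.
move=> /diagonalizablePeigen[r _ r_eig] eqMN.
apply/eqP; rewrite -subr_eq0 -[M - N]mul1mx; apply/eqP/sub_kermxP.
rewrite -r_eig (big_nth 0) big_mkord; apply/sumsmx_subP => i _.
apply/rV_subP => v /eigenspaceP/eqMN eq_v.
by apply/sub_kermxP; rewrite mulmxBr eq_v subrr.
Qed.

Lemma normalmx_diagonalizable (C : numClosedFieldType) n (A : 'M[C]_n) :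
  A \is normalmx -> diagonalizable A.
Proof.
move=> /orthomx_spectralP A_spectral; have P_unit := spectral_unit A.
exists (spectralmx A) => //; apply/(diagonalizable_forLR P_unit).
by exists (spectral_diag A); rewrite mxpoly.conjVmx.
Qed.

Section PowerSpan.
Variables (F : fieldType) (n : nat) (A : 'M[F]_n) (d : nat).

Lemma power_spanP M :
  M \in power_span A d <-> exists c : 'I_d.+1 -> F, M = \sum_k c k *: A ^+ k.
Proof.
split=> [|[c ->]]; last first.
  apply: rpred_sum => k _; apply/rpredZ/memv_span/map_f.
  by rewrite mem_iota ltn_ord.
pose X := [tuple of [seq A ^+ k | k <- iota 0 d.+1]].
move=> /(coord_span (X := X)) ->.
exists (fun k => coord X k M); apply: eq_bigr => k _.
by rewrite (nth_map 0%N) ?size_iota // nth_iota.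
Qed.

Lemma mulmx_sum_expr_eigenvector m (c : 'I_d.+1 -> F) a (v : 'M_(m, n)) :
  v *m A = a *: v ->
  v *m (\sum_k c k *: A ^+ k) = (\sum_k c k * a ^+ k) *: v.
Proof.
move=> vA; rewrite mulmx_sumr scaler_suml; apply: eq_bigr => k _.
by rewrite -scalemxAr -scalerA (mulmx_expr_eigenvector _ vA).
Qed.

Lemma power_span_eigenvector m M a (v : 'M_(n, m)) :
  M \in power_span A d -> A *m v = a *: v -> exists b, M *m v = b *: v.
Proof.
move=> /power_spanP[c ->] Av; exists (\sum_k c k * a ^+ k).
rewrite mulmx_suml scaler_suml; apply: eq_bigr => k _.
by rewrite -scalemxAl -scalerA (expr_mulmx_eigenvector _ Av).
Qed.

Hypothesis A_eig : num_distinct_eigenvalues A d.+1.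

Lemma dim_power_span : \dim (power_span A d) = d.+1.
Proof.
have [a a_inj a_eig] := num_distinct_eigenvaluesP A_eig.
suff /eqnP -> : free [seq A ^+ k | k <- iota 0 d.+1] by rewrite size_tuple.
apply/(freeP (X := [tuple of _])) => c.
rewrite (eq_bigr (fun k : 'I_d.+1 => c k *: A ^+ k)) => [c0|k _].
  have cV0 : \row_k c k *m Vandermonde d.+1 a = 0.
    apply/rowP => j; have : eigenvalue A (a 0 j) by apply/a_eig; exists j.
    move=> /eigenvalueP[v vA v_neq0].
    have /esym/eqP := mulmx_sum_expr_eigenvector c vA.
    rewrite c0 mulmx0 scaler_eq0 (negPf v_neq0) orbF => /eqP c_a.
    by rewrite mxE [RHS]mxE -[RHS]c_a; apply: eq_bigr => k _; rewrite !mxE.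
  have := mulmxK (unitmx_Vandermonde a_inj) (\row_k c k).
  by rewrite cV0 mul0mx => /rowP c_eq0 k; have := c_eq0 k; rewrite !mxE.
by rewrite (nth_map 0%N) ?size_iota // nth_iota.
Qed.

Lemma mem_power_span_eigen (phi : F -> F) M : diagonalizable A ->
  (forall a (v : 'rV_n), v *m A = a *: v -> v *m M = phi a *: v) ->
  M \in power_span A d.
Proof.
move=> A_diag M_phi; have [a a_inj a_eig] := num_distinct_eigenvaluesP A_eig.
pose c := \row_j phi (a 0 j) *m invmx (Vandermonde d.+1 a).
have c_phi j : \sum_k c 0 k * a 0 j ^+ k = phi (a 0 j).
  have := mulmxKV (unitmx_Vandermonde a_inj) (\row_j phi (a 0 j)).
  move/rowP/(_ j); rewrite !mxE => <-.
  by apply: eq_bigr => k _; rewrite [Vandermonde _ _ _ _]mxE.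
apply/power_spanP; exists (c 0).
apply: (eq_mx_on_eigenvectors A_diag) => b v vA.
rewrite (M_phi _ _ vA) (mulmx_sum_expr_eigenvector _ vA).
have [->|v_neq0] := eqVneq v 0; first by rewrite !scaler0.
have [|j ->] := (a_eig b).1; last by rewrite c_phi.
by apply/eigenvalueP; exists v.
Qed.

Lemma expr_mem_power_span h : diagonalizable A -> A ^+ h \in power_span A d.
Proof.
move=> A_diag; apply: (mem_power_span_eigen (phi := fun a => a ^+ h)) => //.
by move=> a v; apply: mulmx_expr_eigenvector.
Qed.

Lemma power_span_mulmxr M : diagonalizable A ->
  M \in power_span A d -> M *m A \in power_span A d.
Proof.
move=> A_diag /power_spanP[c ->]; rewrite mulmx_suml; apply: rpred_sum => k _.
rewrite -scalemxAl -[_ *m _]/(A ^+ k * A) -exprSr rpredZ //.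
exact: expr_mem_power_span.
Qed.

End PowerSpan.

Section EntryClasses.
Variables (F : fieldType) (n : nat) (U : {vspace 'M[F]_n}).

Definition entry_class i j : {set 'I_n * 'I_n} :=
  [set p | all (fun M : 'M[F]_n => M p.1 p.2 == M i j) (vbasis U)].

Definition entry_classes : {set {set 'I_n * 'I_n}} :=
  [set entry_class p.1 p.2 | p : 'I_n * 'I_n].

Lemma mem_entry_class i j i' j' :
  reflect (forall M, M \in U -> M i' j' = M i j) ((i', j') \in entry_class i j).
Proof.
rewrite inE; apply: (iffP allP) => [eqM M MU|eqM M MU]; last first.
  by apply/eqP/eqM/vbasis_mem.
rewrite (coord_vbasis MU) !summxE; apply: eq_bigr => k _; rewrite !mxE.
by congr (_ * _); apply/eqP/eqM/mem_nth; rewrite size_tuple.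
Qed.

Lemma entry_class_eqP i j i' j' :
  reflect (forall M, M \in U -> M i j = M i' j')
          (entry_class i j == entry_class i' j').
Proof.
apply: (iffP eqP) => [eqK M MU|eqM].
  have /mem_entry_class-> // : (i, j) \in entry_class i' j'.
  by rewrite -eqK; apply/mem_entry_class.
apply/setP => -[i2 j2].
by apply/mem_entry_class/mem_entry_class => eqM2 M MU; rewrite eqM2 // eqM.
Qed.

Definition class_mx K : 'M[F]_n := \matrix_(i, j) (entry_class i j == K)%:R.

Lemma sum_class_mxE (c : {set 'I_n * 'I_n} -> F) i j :
  (\sum_(K in entry_classes) c K *: class_mx K) i j = c (entry_class i j).
Proof.
rewrite summxE (bigD1 (entry_class i j)) ?(imset_f _ (x := (i, j))) //= big1.
  by rewrite !mxE eqxx mulr1 addr0.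
by move=> K /andP[_ K_neq]; rewrite !mxE eq_sym (negPf K_neq) mulr0.
Qed.

Lemma class_mx_decomposition M : M \in U ->
  exists c, M = \sum_(K in entry_classes) c K *: class_mx K.
Proof.
move=> MU; pose value K :=
  if [pick p | entry_class p.1 p.2 == K] is Some p then M p.1 p.2 else 0.
exists value; apply/matrixP => i j; rewrite sum_class_mxE /value.
by case: pickP => [p /entry_class_eqP ->|/(_ (i, j))]; rewrite ?eqxx.
Qed.

Lemma class_mx_free : free [seq class_mx K | K in entry_classes].
Proof.
apply/(freeP (X := [tuple of _])) => c c0 k.
have /imsetP[[i j] _ Kij] := enum_valP k.
move/matrixP/(_ i j): c0; rewrite summxE (bigD1 k) //= big1 => [|h h_neq_k].
  by rewrite nth_image !mxE Kij eqxx mulr1 addr0.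
rewrite nth_image !mxE -Kij (inj_eq enum_val_inj) eq_sym (negPf h_neq_k).
exact: mulr0.
Qed.

Hypotheses (U_had : hadamard_closed U) (ones_mem : const_mx 1 \in U).

Lemma separating_mx i j i' j' : entry_class i j != entry_class i' j' ->
  exists M, [/\ M \in U, M i j = 1 & M i' j' = 0].
Proof.
move=> neqK; have [N NU N_sep] : exists2 N, N \in U & N i j - N i' j' != 0.
  suff : (i, j) \notin entry_class i' j'.
    by rewrite inE => /allPn[N /vbasis_mem NU]; rewrite -subr_eq0; exists N.
  apply: contraNN neqK => /mem_entry_class eqM; exact/entry_class_eqP.
exists ((N i j - N i' j')^-1 *: (N - N i' j' *: const_mx 1)); split.
- by rewrite rpredZ ?rpredB ?rpredZ.
- by rewrite !mxE mulr1 mulVf.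
- by rewrite !mxE mulr1 subrr mulr0.
Qed.

Lemma class_mx_mem K : class_mx K \in U.
Proof.
case: (pickP (fun p => entry_class p.1 p.2 == K)) => [[i j] /eqP/= defK|no_p];
  last first.
  suff -> : class_mx K = 0 by apply: mem0v.
  by apply/matrixP => i j; rewrite !mxE [_ == _](no_p (i, j)).
(* The class matrix of [K] is a Hadamard product of matrices of [U], one for
   each pair outside [K], which vanish at that pair and are [1] at [(i, j)]. *)
have /fin_all_exists[N NP] p : exists M, [/\ M \in U, M i j = 1 &
    entry_class p.1 p.2 != K -> M p.1 p.2 = 0].
  have [_|neqK] := eqVneq (entry_class p.1 p.2) K.
    by exists (const_mx 1); rewrite mxE.
  rewrite -defK eq_sym in neqK.
  by have [M [MU Mij Mp]] := separating_mx neqK; exists M.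
pose M := \big[@hadamard F n/const_mx 1]_p N p.
have ME i' j' : M i' j' = \prod_p N p i' j'.
  by apply: (big_morph (fun M : 'M[F]_n => M i' j')) => [? ?|]; rewrite mxE.
have MU : M \in U.
  by apply: (big_ind (fun M => M \in U)) => // p _; case: (NP p).
suff -> : class_mx K = M by [].
apply/matrixP => i' j'; rewrite mxE -{1}defK.
have [/eqP/entry_class_eqP -> //|neqK] := eqVneq.
  by rewrite ME big1 // => p _; case: (NP p).
have [_ _ Nij'0] := NP (i', j').
by rewrite ME (bigD1 (i', j')) //= Nij'0 ?mul0r // -defK.
Qed.

Lemma card_entry_classes : #|entry_classes| = \dim U.
Proof.
apply/esym/(size_basis (X := [tuple of image class_mx entry_classes])).
rewrite /basis_of class_mx_free andbT eqEsubv; apply/andP; split.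
  by apply/span_subvP => _ /imageP[K _ ->]; apply: class_mx_mem.
apply/subvP => M /class_mx_decomposition[c ->].
by apply: rpred_sum => K KU; apply/rpredZ/memv_span/image_f.
Qed.

End EntryClasses.

Section WalkCounting.
Variables (C : numClosedFieldType) (T : finType) (e : rel T).
Let A := adjacency_matrix C e.

Lemma adjacency_matrixE x y : A (enum_rank x) (enum_rank y) = (e x y)%:R.
Proof. by rewrite mxE !enum_rankK. Qed.

Lemma expr_adjacency_matrix h x y :
  (A ^+ h) (enum_rank x) (enum_rank y) =
  #|[set p : h.-tuple T | path e x p && (last x p == y)]|%:R.
Proof.
rewrite -sumr_indicator; under eq_bigr do rewrite inE.
elim: h x => [|h IH] x.
  rewrite (big_pred1 [tuple]) => [|p]; last exact/esym/eqP/tuple0.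
  by rewrite expr0 mxE /= (inj_eq enum_rank_inj).
rewrite exprS mxE sum_enum_rank.
rewrite (reindex (fun zp : T * h.-tuple T => [tuple of zp.1 :: zp.2])).
  rewrite -(pair_bigA _ (fun z (p : h.-tuple T) =>
    (path e x (z :: p) && (last x (z :: p) == y))%:R)) /=.
  apply: eq_bigr => z _; rewrite IH adjacency_matrixE mulr_sumr.
  by apply: eq_bigr => p _; rewrite -andbA -natrM mulnb.
exists (fun p => (thead p, [tuple of behead p])) => [[z p] _|p _] /=.
  by congr (_, _); apply: val_inj.
by rewrite -tuple_eta.
Qed.

Lemma walk_of_length_expr h x y :
  walk_of_length e x y h = ((A ^+ h) (enum_rank x) (enum_rank y) != 0).
Proof.
rewrite expr_adjacency_matrix pnatr_eq0 cards_eq0.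
by apply/existsP/set0Pn => -[p]; [|rewrite inE]; exists p; rewrite ?inE.
Qed.

End WalkCounting.

Section HarmonicFunctions.
Variables (C : numClosedFieldType) (T : finType) (e : rel T).
Hypothesis e_sym : symmetric e.

Lemma dirichlet_form (f : T -> C) :
  \sum_x \sum_y (e x y)%:R * `|f x - f y| ^+ 2 =
  (\sum_x (\sum_y (e x y)%:R * (f x - f y)) * (f x)^* ) *+ 2.
Proof.
pose D x y : C := (e x y)%:R * (f x - f y) * (f x)^*.
under [in RHS]eq_bigr => x _ do rewrite mulr_suml -[BIG_F]/(D x).
rewrite mulr2n [X in _ + X]exchange_big -big_split /=.
apply: eq_bigr => x _; rewrite -big_split; apply: eq_bigr => y _.
by rewrite /D (e_sym y x) normCK rmorphB /=; ring.
Qed.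

Lemma harmonic_const (f : T -> C) : connected_graph e ->
  (forall x, \sum_y (e x y)%:R * (f x - f y) = 0) -> forall x y, f x = f y.
Proof.
move=> e_conn f_harm.
have ge0 x y : 0 <= (e x y)%:R * `|f x - f y| ^+ 2.
  by rewrite mulr_ge0 ?ler0n ?exprn_ge0.
have f_adj x y : e x y -> f x = f y.
  move=> xy; have /eqP := dirichlet_form f.
  rewrite [in eqbRHS]big1 ?mul0rn => [|z _]; last by rewrite f_harm mul0r.
  rewrite psumr_eq0 => [|z _]; last exact: sumr_ge0.
  move=> /allP/(_ x (mem_index_enum _)); rewrite psumr_eq0 //.
  move=> /allP/(_ y (mem_index_enum _)) /=.
  by rewrite xy mul1r sqrf_eq0 normr_eq0 subr_eq0 => /eqP.
move=> x y; have /connectP[p + ->] := e_conn x y.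
by elim: p x => //= z p IH x /andP[/f_adj -> /IH].
Qed.

End HarmonicFunctions.

Section RegularGraph.
Variables (C : numClosedFieldType) (T : finType) (e : rel T).
Hypothesis e_sym : symmetric e.
Let A := adjacency_matrix C e.

Lemma adjacency_matrix_diagonalizable : diagonalizable A.
Proof.
apply/normalmx_diagonalizable/symmetric_normalmx.
  apply/is_hermitianmxP; rewrite expr0 scale1r map_mx_id //.
  by apply/matrixP => i j; rewrite !mxE e_sym.
by apply/mxOverP => i j; rewrite mxE realn.
Qed.

Lemma sum_adjacency_row x : \sum_y (e x y)%:R = #|neighbours e x|%:R :> C.
Proof. by rewrite -sumr_indicator; apply: eq_bigr => y _; rewrite inE. Qed.

Variable k : nat.
Hypothesis e_reg : forall x, #|neighbours e x| = k.

Lemma adjacency_matrix_mul_ones :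
  A *m const_mx 1 = k%:R *: const_mx 1 :> 'cV_#|T|.
Proof.
apply/colP => i; rewrite mulmx_onesE !mxE mulr1 -(e_reg (enum_val i)).
rewrite -sum_adjacency_row sum_enum_rank.
by apply: eq_bigr => x _; rewrite mxE enum_rankK.
Qed.

Lemma valency_eigenvector_const (v : 'rV_#|T|) : connected_graph e ->
  v *m A = k%:R *: v -> forall i j, v 0 i = v 0 j.
Proof.
move=> e_conn vA i j; rewrite -[i]enum_valK -[j]enum_valK.
apply: (harmonic_const (f := fun x => v 0 (enum_rank x)) e_sym e_conn) => x.
under eq_bigr do rewrite mulrBr.
rewrite sumrB -mulr_suml sum_adjacency_row e_reg.
apply/eqP; rewrite subr_eq0; apply/eqP.
move/rowP/(_ (enum_rank x)): vA; rewrite !mxE => <-.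
rewrite sum_enum_rank; apply: eq_bigr => y _.
by rewrite adjacency_matrixE e_sym mulrC.
Qed.

Variable d : nat.

Lemma power_span_row_sum M : M \in power_span A d ->
  exists c, forall i, \sum_j M i j = c.
Proof.
move=> /power_span_eigenvector/(_ adjacency_matrix_mul_ones)[c Mc].
by exists c => i; rewrite -(mulmx_onesE M i (ord0 : 'I_1)) Mc !mxE mulr1.
Qed.

Lemma ones_mem_power_span :
  connected_graph e -> num_distinct_eigenvalues A d.+1 ->
  const_mx 1 \in power_span A d.
Proof.
move=> e_conn A_eig.
pose phi (a : C) : C := if a == k%:R then #|T|%:R else 0.
have A_diag := adjacency_matrix_diagonalizable.
apply: (mem_power_span_eigen A_eig (phi := phi) A_diag) => a v vA.
apply/rowP => j; rewrite mulmx_onesE mxE /phi.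
have [a_k|a_neq_k] := eqVneq.
  rewrite a_k in vA; have v_const := valency_eigenvector_const e_conn vA.
  by rewrite (eq_bigr (fun=> v 0 j)) // sumr_const card_ord mulr_natl.
have /eqP := mulmxA v A (const_mx 1 : 'cV_#|T|).
rewrite adjacency_matrix_mul_ones vA -scalemxAl -scalemxAr eq_sym.
rewrite -subr_eq0 -scalerBl scaler_eq0 subr_eq0 (negPf a_neq_k) mul0r.
by move=> /eqP/rowP/(_ 0); rewrite mulmx_onesE mxE.
Qed.

End RegularGraph.

Lemma indexed_partition_fibres (T : finType) (L : eqType) (f : T -> L) r
    (l : 'I_r.+1 -> L) :
  injective l -> (forall y, exists i, f y = l i) ->
  (forall i, exists y, f y = l i) ->
  Defs.indexed_partition (fun i => [set y | f y == l i]).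
Proof.
move=> l_inj f_l l_f; pose P i := [set y | f y == l i].
have [||P_part P_inj] := finset.indexed_partition (J := predT) (B := P).
- move=> i j _ _; apply: contraNT => /pred0Pn[y] /=.
  by rewrite !inE => /andP[/eqP -> /eqP/l_inj ->].
- by move=> i _; have [y fy] := l_f i; apply/set0Pn; exists y; rewrite inE fy.
split=> [i j|]; first exact: P_inj.
suff <- : cover [set P i | i in predT] = [set: T] by [].
apply/setP => y; rewrite inE; have [i fy] := f_l y.
by apply/bigcupP; exists (P i); rewrite ?imset_f // inE fy.
Qed.

Lemma enum_set_from (T : finType) (S : {set T}) a r :
  a \in S -> #|S| = r.+1 ->
  exists f : 'I_r.+1 -> T,
    [/\ injective f, f ord0 = a & f @: [set: 'I_r.+1] = S].
Proof.
move=> aS S_card; pose s := a :: enum (S :\ a).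
have s_size : size s = r.+1 by rewrite /= -cardE -S_card (cardsD1 a S) aS.
have s_uniq : uniq s by rewrite /= enum_uniq mem_enum !inE eqxx.
have mem_s b : (b \in s) = (b \in S).
  by rewrite inE mem_enum !inE; case: eqVneq => // ->.
exists (fun i => nth a s i); split=> // [i j /eqP|].
  by rewrite nth_uniq ?s_size // => /eqP/val_inj.
apply/setP => b; rewrite -mem_s.
apply/imsetP/(nthP a) => [[i _ ->]|[i lt_i <-]].
  by exists i; rewrite ?s_size.
by rewrite s_size in lt_i; exists (Ordinal lt_i).
Qed.

Lemma sphere_distance_partition (T : finType) (e : rel T) x y :
  sphere e x (gdist e x y) \in distance_partition e x.
Proof.
have lt_ecc : (gdist e x y < (eccentricity e x).+1)%N.
  by rewrite ltnS (leq_bigmax y).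
by apply/imsetP; exists (Ordinal lt_ecc).
Qed.

Section PairColouring.
Variables (T L : finType) (e : rel T) (colour : T -> T -> L) (d : nat).

Definition colours : {set L} := [set colour p.1 p.2 | p : T * T].

Definition cell (l : L) (x : T) : {set T} := [set y | colour x y == l].

Hypothesis card_colours : #|colours| = d.+1.
Hypothesis colour_diag : forall x y z, (colour x y == colour z z) = (x == y).
Hypothesis gdist_colour :
  forall x y x' y', colour x y = colour x' y' -> gdist e x y = gdist e x' y'.
Hypothesis card_cell : forall l x x', #|cell l x| = #|cell l x'|.
Hypothesis card_neighbours_cell :
  forall l x y x' y', colour x y = colour x' y' ->
    #|neighbours e y :&: cell l x| = #|neighbours e y' :&: cell l x'|.

Lemma colour_surj l x : l \in colours -> exists y, colour x y = l.
Proof.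
move=> /imsetP[[x' y'] _ ->] /=; set l' := colour x' y'.
suff /set0Pn[y] : cell l' x != set0 by rewrite inE => /eqP; exists y.
rewrite -card_gt0 (card_cell _ _ x') card_gt0.
by apply/set0Pn; exists y'; rewrite inE.
Qed.

Lemma cells_distance_faithful (l : 'I_d.+1 -> L) u z :
  injective l -> l ord0 = colour z z -> l @: [set: 'I_d.+1] = colours ->
  distance_faithful e u (fun i => cell (l i) u).
Proof.
move=> l_inj l_diag l_colours.
have l_surj i : exists y, colour u y = l i.
  by apply: colour_surj; rewrite -l_colours imset_f.
split=> [||i].
- apply: indexed_partition_fibres => // y.
  have : colour u y \in colours by apply: (imset_f _ (x := (u, y))).
  by rewrite -l_colours => /imsetP[i _ ->]; exists i.
- by apply/setP => y; rewrite !inE l_diag colour_diag eq_sym.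
have [y uy] := l_surj i.
exists (sphere e u (gdist e u y)); first exact: sphere_distance_partition.
apply/subsetP => y'; rewrite !inE -uy => /eqP/gdist_colour ->.
exact: eqxx.
Qed.

Lemma colouring_same_diagram : same_diagram_around_every_vertex e d.
Proof.
have /card_gt0P[_ /imsetP[[x0 _] _ _]] : (0 < #|colours|)%N.
  by rewrite card_colours.
have diag_colour : colour x0 x0 \in colours.
  exact: (imset_f _ (x := (x0, x0))).
have [l [l_inj l_diag l_colours]] := enum_set_from diag_colour card_colours.
have /fin_all_exists[rep repP] i : exists y, colour x0 y = l i.
  by apply: colour_surj; rewrite -l_colours imset_f.
exists (fun i j => #|neighbours e (rep i) :&: cell (l j) x0|).
exists (fun i => #|cell (l i) x0|), (fun i => gdist e x0 (rep i)) => u.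
have cellP i y : y \in cell (l i) u -> colour u y = colour x0 (rep i).
  by rewrite inE repP => /eqP.
exists (fun i => cell (l i) u); split=> [|i j y /cellP|i|i y /cellP].
- exact: cells_distance_faithful l_inj l_diag l_colours.
- exact: card_neighbours_cell.
- exact: card_cell.
- exact: gdist_colour.
Qed.

End PairColouring.

Lemma same_diagram_has_diagram (T : finType) (e : rel T) r x :
  same_diagram_around_every_vertex e r -> has_distance_faithful_diagram e x r.
Proof.
move=> [c [s [delta /(_ x)[P [P_df P_eq _ _]]]]].
by exists P; split=> //; exists c.
Qed.

Section PairClasses.
Variables (C : numClosedFieldType) (T : finType) (e : rel T) (d k : nat).
Hypotheses (e_sym : symmetric e) (e_reg : forall x, #|neighbours e x| = k).
Let A := adjacency_matrix C e.
Let V := power_span A d.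
Hypothesis A_eig : num_distinct_eigenvalues A d.+1.
Hypothesis V_had : hadamard_closed V.
Hypothesis ones_mem : const_mx 1 \in V.

Definition pair_class x y := entry_class V (enum_rank x) (enum_rank y).

Let A_diag : diagonalizable A := adjacency_matrix_diagonalizable C e_sym.

Lemma power_span_pair_class M x y x' y' :
  M \in V -> pair_class x y = pair_class x' y' ->
  M (enum_rank x) (enum_rank y) = M (enum_rank x') (enum_rank y').
Proof. by move=> MV /eqP/entry_class_eqP ->. Qed.

Lemma card_pair_classes : #|colours pair_class| = d.+1.
Proof.
rewrite -(dim_power_span A_eig) -(card_entry_classes V_had ones_mem).
congr #|pred_of_set _|; apply/setP => K; apply/imsetP/imsetP => -[[x y] _ ->].
  by exists (enum_rank x, enum_rank y).
by exists (enum_val x, enum_val y) => //; rewrite /pair_class !enum_valK.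
Qed.

Lemma power_span_diag M i j : M \in V -> M i i = M j j.
Proof.
move=> MV; have M1_mem : hadamard M 1 \in V.
  by apply: V_had => //; apply: (expr_mem_power_span A_eig 0 A_diag).
have [c row_c] := power_span_row_sum e_reg M1_mem.
suff diag_c h : M h h = c by rewrite !diag_c.
rewrite -(row_c h) (bigD1 h) //= big1 => [|h' neq_h].
  by rewrite addr0 !mxE eqxx mulr1.
by rewrite !mxE eq_sym (negPf neq_h) mulr0.
Qed.

Lemma pair_class_diag x y z : (pair_class x y == pair_class z z) = (x == y).
Proof.
apply/idP/eqP => [/eqP eqK|->]; last first.
  by apply/entry_class_eqP => M; apply: power_span_diag.
have := power_span_pair_class (expr_mem_power_span A_eig 0 A_diag) eqK.
rewrite !mxE eqxx (inj_eq enum_rank_inj); case: eqP => // _ /eqP.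
by rewrite eq_sym oner_eq0.
Qed.

Lemma gdist_pair_class x y x' y' :
  pair_class x y = pair_class x' y' -> gdist e x y = gdist e x' y'.
Proof.
move=> eqK; apply: eq_find => h; rewrite !(walk_of_length_expr C).
by rewrite (power_span_pair_class (expr_mem_power_span A_eig h A_diag) eqK).
Qed.

Lemma card_cell_pair_class K x x' :
  #|cell pair_class K x| = #|cell pair_class K x'|.
Proof.
have [c row_c] := power_span_row_sum e_reg (class_mx_mem V_had ones_mem K).
suff cell_c z : #|cell pair_class K z|%:R = c :> C.
  by apply/eqP; rewrite -(eqr_nat C) !cell_c.
rewrite -(row_c (enum_rank z)) sum_enum_rank -sumr_indicator.
by apply: eq_bigr => y _; rewrite mxE inE.
Qed.

Lemma card_neighbours_cell_pair_class K x y x' y' :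
  pair_class x y = pair_class x' y' ->
  #|neighbours e y :&: cell pair_class K x| =
  #|neighbours e y' :&: cell pair_class K x'|.
Proof.
have KA := power_span_mulmxr A_eig A_diag (class_mx_mem V_had ones_mem K).
have cardE z w : (class_mx V K *m A) (enum_rank z) (enum_rank w) =
    #|neighbours e w :&: cell pair_class K z|%:R.
  rewrite mxE sum_enum_rank -sumr_indicator; apply: eq_bigr => v _.
  by rewrite adjacency_matrixE mxE !inE -natrM mulnb e_sym andbC.
move/(power_span_pair_class KA); rewrite !cardE => /eqP.
by rewrite eqr_nat => /eqP.
Qed.

End PairClasses.

Theorem theorem1p3 (C : numClosedFieldType) (T : finType) (e : rel T) (d : nat)
    (e_sym : symmetric e) (e_irr : irreflexive e)
    (e_conn : connected_graph e) (e_reg : regular_graph e)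
    (e_eig : num_distinct_eigenvalues (adjacency_matrix C e) d.+1)
    (e_had : hadamard_closed (power_span (adjacency_matrix C e) d)) :
  (forall x : T, has_distance_faithful_diagram e x d) /\
  same_diagram_around_every_vertex e d.
Proof.
have [k e_k] := e_reg.
have ones_mem := ones_mem_power_span e_sym e_k e_conn e_eig.
suff same : same_diagram_around_every_vertex e d.
  by split=> // x; apply: same_diagram_has_diagram same.
apply: (colouring_same_diagram (colour := pair_class C e d)).
- exact: card_pair_classes.
- exact: pair_class_diag e_sym e_k e_eig e_had.
- exact: gdist_pair_class.
- exact: card_cell_pair_class e_k e_had ones_mem.
- exact: card_neighbours_cell_pair_class.
Qed.
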